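(* Let $\mathbf{s}\in\mathbb{R}^n$ be the signal to be decomposed. Let $\mathbf{v}$ be a symmetric decreasing filter of length $l'$ with $0<l'\le\lfloor\frac{n-1}{4}\rfloor$, and let $\mathbf{w}=\mathbf{v}\ast\mathbf{v}$ be another symmetric decreasing filter, of length $l$ with $0<l\le\lfloor\frac{n-1}{2}\rfloor$, defined as the convolution of $\mathbf{v}$ with itself. Let $\mathcal{BC}\in\{\mathcal{P},\mathcal{R},\mathcal{AR}\}$ denote Periodic, Reflective or Anti-Reflective boundary conditions, and let $W^{\mathcal{BC}}\in\mathbb{R}^{n\times n}$ be the structured matrix constructed from $\mathbf{w}$ and the boundary conditions $\mathcal{BC}$. Then $\sigma(W^{\mathcal{BC}})\subseteq[0,1]$. Moreover, the eigenvalues of $W^{\mathcal{BC}}$, counted with multiplicity, can be enumerated as $\lambda_1^{\mathcal{BC}},\ldots,\lambda_n^{\mathcal{BC}}$ so that: - in the Periodic case, $\lambda_1^{\mathcal{P}}=1$ and $\lambda_i^{\mathcal{P}}\in[0,1)$ for $i=2,\ldots,n$; - in the Reflective case, $\lambda_1^{\mathcal{R}}=1$ and $\lambda_i^{\mathcal{R}}\in[0,1)$ for $i=2,\ldots,n$; - in the Anti-Reflective case, $\lambda_1^{\mathcal{AR}}=\lambda_2^{\mathcal{AR}}=1$ and $\lambda_i^{\mathcal{AR}}\in[0,1)$ for $i=3,\ldots,n$.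
   Context: Filters. A filter of length $l$ (with $0<l\le\lfloor\frac{n-1}{2}\rfloor$) is a non-negative vector $\mathbf{w}=(0,\ldots,0,w_{-l},\ldots,w_{-1},w_0,w_1,\ldots,w_l,0,\ldots,0)\in\mathbb{R}^n$ with $w_j>0$ for $j=-l,\ldots,l$ and $\sum_{j=-l}^{l}w_j=1$. It is symmetric if $w_{-j}=w_j$ for $j=1,\ldots,l$. It is decreasing if $w_i\ge w_j$ whenever $0\le i<j$, and $w_i\ge w_j$ whenever $j<i\le 0$. The convolution $\mathbf{w}=\mathbf{v}\ast\mathbf{v}$ is given by $w_k=\sum_{j}v_jv_{k-j}$ (with $v_j=0$ for $|j|>l'$), so that $l=2l'$. Boundary conditions. A signal $\mathbf{s}=(s_0,\ldots,s_{n-1})^T\in\mathbb{R}^n$ is extended to indices $-l,\ldots,n-1+l$ by setting $s^{\mathcal{BC}}_i=s_i$ for $0\le i\le n-1$ and, for $j=1,\ldots,l$: - Periodic ($\mathcal{P}$): $s^{\mathcal{P}}_{-j}=s_{n-j}$, $s^{\mathcal{P}}_{n-1+j}=s_{j-1}$; - Reflective ($\mathcal{R}$): $s^{\mathcal{R}}_{-j}=s_{j-1}$, $s^{\mathcal{R}}_{n-1+j}=s_{n-j}$; - Anti-Reflective ($\mathcal{AR}$): $s^{\mathcal{AR}}_{-j}=2s_0-s_j$, $s^{\mathcal{AR}}_{n-1+j}=2s_{n-1}-s_{n-1-j}$. Structured matrix. $W^{\mathcal{BC}}\in\mathbb{R}^{n\times n}$ is the matrix of the linear map $\mathbf{s}\mapsto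 W^{\mathcal{BC}}\mathbf{s}$ given by $(W^{\mathcal{BC}}\mathbf{s})_i=\sum_{j=i-l}^{i+l}w_{|i-j|}\,s^{\mathcal{BC}}_j$ for $i=0,\ldots,n-1$. $\sigma(\cdot)$ denotes the spectrum. *)

(* Defs.v *)
From HB Require Import structures.
From mathcomp Require Import all_boot all_order all_algebra.
From mathcomp Require Import reals complex.

Set Implicit Arguments.
Unset Strict Implicit.
Unset Printing Implicit Defensive.

Import Order.TTheory GRing.Theory Num.Theory.
Local Open Scope ring_scope.

Section Filters.
Variable R : realType.

(* The sum of F j over the integers j with c - l <= j <= c + l. *)
Definition wsum (c : int) (l : nat) (F : int -> R) : R :=
  \sum_(k < l.*2.+1) F (c - l%:Z + k%:Z).

(* The vector of R^n holding a filter is represented by its coefficients at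
   all integer indices, which vanish outside the window -l, ..., l; the bound
   on l says that this window fits in n entries. *)
Record is_filter (n l : nat) (w : int -> R) : Prop := IsFilter {
  filter_length_gt0 : (0 < l)%N;
  filter_length_le : (l <= n.-1 %/ 2)%N;
  filter_gt0 : forall j : int, (`|j| <= l)%N -> 0 < w j;
  filter_eq0 : forall j : int, (l < `|j|)%N -> w j = 0;
  filter_sum1 : wsum 0 l w = 1
}.

Definition symmetric_filter (l : nat) (w : int -> R) : Prop :=
  forall j : nat, (1 <= j <= l)%N -> w (- j%:Z) = w j%:Z.

Definition decreasing_filter (w : int -> R) : Prop :=
  (forall i j : int, 0 <= i -> i < j -> w j <= w i) /\
  (forall i j : int, j < i -> i <= 0 -> w j <= w i).

Definition self_conv (l : nat) (v : int -> R) : int -> R :=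
  fun k => wsum 0 l (fun j => v j * v (k - j)).

End Filters.

Inductive boundary := Periodic | Reflective | AntiReflective.

Section Structured.
Variables (R : realType) (n : nat).

(* s_k, with the junk value 0 when k >= n. *)
Definition entry (s : 'cV[R]_n) (k : nat) : R :=
  oapp (fun i : 'I_n => s i 0) 0 (insub k).

(* Meant for -l <= i <= n - 1 + l with l <= (n - 1) / 2, where no index read
   from s is out of range and no subtraction on nat is truncated. The pattern
   Negz p stands for the index - p.+1. *)
Definition extend (bc : boundary) (s : 'cV[R]_n) (i : int) : R :=
  match i with
  | Posz p =>
      if (p < n)%N then entry s p else
      let j := (p - n.-1)%N in
      match bc with
      | Periodic => entry s (j - 1)
      | Reflective => entry s (n - j)
      | AntiReflective => 2 * entry s n.-1 - entry s (n.-1 - j)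
      end
  | Negz p =>
      let j := p.+1 in
      match bc with
      | Periodic => entry s (n - j)
      | Reflective => entry s (j - 1)
      | AntiReflective => 2 * entry s 0 - entry s j
      end
  end.

Definition filter_map (bc : boundary) (l : nat) (w : int -> R)
    (s : 'cV[R]_n) : 'cV[R]_n :=
  \col_(i < n) wsum i%:Z l (fun j => w `|i%:Z - j|%N%:Z * extend bc s j).

Definition structured_mx (bc : boundary) (l : nat) (w : int -> R) : 'M[R]_n :=
  \matrix_(i < n, j < n) filter_map bc l w (delta_mx j 0) i 0.

Lemma entry_lin a (s t : 'cV[R]_n) k :
  entry (a *: s + t) k = a * entry s k + entry t k.
Proof.
by rewrite /entry; case: insub => [i|] /=; rewrite ?mxE // mulr0 addr0.
Qed.

Lemma extend_lin bc a s t i :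
  extend bc (a *: s + t) i = a * extend bc s i + extend bc t i.
Proof.
have D (x y x' y' : R) : 2 * (a * x + y) - (a * x' + y')
    = a * (2 * x - x') + (2 * y - y').
  by rewrite mulrDr mulrBr opprD mulrCA addrACA.
rewrite /extend; case: i => p; last by case: bc; rewrite !entry_lin ?D.
by case: ifP => _; last case: bc; rewrite !entry_lin ?D.
Qed.

Lemma filter_map_linear bc l w : linear (filter_map bc l w).
Proof.
move=> a s t; apply/matrixP => i j; rewrite !mxE /wsum mulr_sumr -big_split.
apply: eq_bigr => k _ /=.
by rewrite extend_lin mulrDr mulrCA.
Qed.

Lemma structured_mxE bc l w s : structured_mx bc l w *m s = filter_map bc l w s.
Proof.
pose f := GRing.isLinear.Build _ _ _ _ _ (filter_map_linear bc l w).
pose F : {linear 'cV[R]_n -> 'cV[R]_n} := HB.pack (filter_map bc l w) f.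
have -> : filter_map bc l w s = \sum_j s j 0 *: F (delta_mx j 0).
  rewrite -[LHS]/(F s) {1}(matrix_sum_delta s) linear_sum.
  by apply: eq_bigr => j _; rewrite big_ord1 linearZ.
apply/matrixP => i k; rewrite ord1 summxE mxE; apply: eq_bigr => j _.
by rewrite !mxE mulrC.
Qed.

End Structured.

(* Main.v *)
Require Import Defs.
From mathcomp Require Import all_boot all_order all_algebra.
From mathcomp Require Import reals complex.
From mathcomp Require Import perm spectral zify ring lra.

(** Every boundary condition continues a signal to a periodic sequence on the
    whole of Z on which the filter acts as a plain convolution: the period is n
    in the periodic case, 2n after an even reflection in the reflective case,
    and 2(n-1) after an odd reflection in the anti-reflective case, provided in
    that last case that the signal vanishes at both ends ([unroll],
    [unroll_filter_map]). The scalar product over a period is, up to a factor 1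
    or 2, the usual one on vectors ([dot_unroll]), and convolution by an even
    filter is self-adjoint for it ([dot_conv_adj]), so the bilinear form of the
    matrix is symmetric on the signals concerned.

    Let f be a nonzero periodic sequence with w * f = a f. Two energy
    identities locate a. Since w = v * v, we have
    a <f, f> = <v * f, v * f>, hence 0 <= a. And the Dirichlet form
      sum_k w_k sum_x (f (x + k) - f x)^2 = 2 (1 - a) <f, f>
    is nonnegative, hence a <= 1; if a = 1 then the term k = 1 vanishes, and as
    w_1 > 0 the sequence f is constant ([conv_eigenvalue]).

    In the periodic and reflective cases the matrix W is symmetric, hence
    diagonalisable over R, and the multiplicity of 1 is the dimension of the
    space of constant vectors, which are indeed fixed because w sums to 1
    ([simple_top_spectrum]). In the anti-reflective case the end samples are
    left unchanged, so the first and last rows of W are those of the identity,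
    and expanding the determinant splits off (X - 1)^2; what remains is
    the inner block of W, which is symmetric and acts on the signals vanishing
    at both ends. There no nonzero signal unrolls to a constant, so all its
    eigenvalues are in [0, 1[ ([anti_reflective_spectrum]). *)

Set Implicit Arguments.
Unset Strict Implicit.
Unset Printing Implicit Defensive.

Import Order.TTheory GRing.Theory Num.Theory.
Local Open Scope ring_scope.

(** * Characteristic polynomials and symmetric matrices *)

(** Laplace expansion along row i, in which only the diagonal entry of
    X - A survives. *)
Lemma char_poly_scalar_row (R : comNzRingType) n (A : 'M[R]_n) i c :
  (forall j, A i j = c *+ (i == j)) ->
  char_poly A = ('X - c%:P) * char_poly (row' i (col' i A)).
Proof.
move=> Ai; rewrite /char_poly (expand_det_row _ i) (bigD1 i) //= big1.
  rewrite addr0 /cofactor addnn -signr_odd odd_double mul1r !mxE eqxx Ai eqxx.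
  congr (_ * \det _); apply/matrixP => j k.
  by rewrite !mxE (inj_eq lift_inj).
by move=> j; rewrite eq_sym => /negPf nij; rewrite !mxE Ai nij subrr mul0r.
Qed.

Lemma char_poly_similar (R : comUnitRingType) n (A B P : 'M[R]_n) :
  P \in unitmx -> A = invmx P *m B *m P -> char_poly A = char_poly B.
Proof.
move=> uP ->; pose Q := map_mx polyC P; pose Q' := map_mx polyC (invmx P).
have QQ : Q' *m Q = 1%:M by rewrite -map_mxM mulVmx // map_mx1.
have -> : char_poly (invmx P *m B *m P) = \det (Q' *m char_poly_mx B *m Q).
  rewrite /char_poly /char_poly_mx mulmxBr mulmxBl !map_mxM.
  by rewrite scalar_mxC -(mulmxA _ Q') QQ mulmx1.
by rewrite !det_mulmx mulrAC -det_mulmx QQ det1 mul1r.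
Qed.

Lemma mxrank_rowsub_inj (F : fieldType) k m (f : 'I_k -> 'I_m) (P : 'M[F]_m) :
  injective f -> P \in unitmx -> \rank (rowsub f P) = k.
Proof.
move=> injf uP; rewrite rowsubE mxrankMfree ?row_free_unit //.
apply/eqP; apply/row_freeP; exists (rowsub f 1%:M)^T.
apply/matrixP => i j; rewrite !mxE (bigD1 (f j)) //= !mxE eqxx mulr1 big1.
  by rewrite addr0 (inj_eq injf).
by move=> a; rewrite eq_sym !mxE => /negPf ->; rewrite mulr0.
Qed.

(** The spectral theorem over R, obtained by viewing A as a Hermitian matrix
    over R[i], whose eigenvalues are real. Over R[i] the rows of the unitary
    matrix P with A = P^-1 D P that belong to the eigenvalue a are independent
    eigenvectors; the rank of an eigenspace does not change under the field
    extension, so the multiplicity of a is bounded by the rank over R. *)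
Lemma symmetric_spectrum (R : rcfType) m (A : 'M[R]_m) : A^T = A ->
  exists2 d : 'I_m -> R, char_poly A = \prod_i ('X - (d i)%:P)
    & forall a, (#|[set i | d i == a]| <= \rank (eigenspace A a))%N.
Proof.
move=> symA; pose f : {rmorphism R -> R[i]} := real_complex R.
pose AC := map_mx f A.
have hermA : AC \is hermsymmx.
  apply: realsym_hermsym.
    apply/is_hermitianmxP; rewrite expr0 scale1r map_mx_id //.
    by rewrite /AC map_trmx symA.
  by apply/mxOverP => i j; rewrite mxE; apply/complex_realP; exists (A i j).
have realD := hermitian_spectral_diag_real hermA.
have /orthomx_spectralP defA := hermitian_normalmx hermA.
set P := spectralmx AC in defA; set D := spectral_diag AC in defA realD.
have uP : P \in unitmx by apply: spectral_unit.
pose d i := complex.Re (D 0 i).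
have fd i : D 0 i = f (d i).
  by have /mxOverP/(_ 0 i)/RRe_real := realD.
exists d => [|a].
  apply: (map_poly_inj f); rewrite map_char_poly (char_poly_similar uP defA).
  rewrite char_poly_trig ?diag_mx_is_trig // rmorph_prod.
  apply: eq_bigr => i _.
  by rewrite mxE eqxx mulr1n fd rmorphB /= map_polyX map_polyC.
rewrite -(mxrank_map f) map_eigenspace.
rewrite -[leqLHS](mxrank_rowsub_inj enum_val_inj uP).
apply/mxrankS/eigenspaceP.
rewrite -/AC mul_rowsub_mx defA !mulmxA -/P mulmxV // mul1mx.
apply/matrixP => i j; rewrite mul_diag_mx !mxE fd.
by have /[!inE]/eqP -> := enum_valP i.
Qed.

(** Two expansions along a row; [h] renumbers the indices that remain. *)
Lemma char_poly_scalar_ends (R : comNzRingType) m (A : 'M[R]_m.+2) c :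
  let h i := lift ord0 (lift (ord_max : 'I_m.+1) i) in
  (forall j, A ord0 j = c *+ (ord0 == j)) ->
  (forall j, A ord_max j = c *+ (ord_max == j)) ->
  char_poly A = ('X - c%:P) ^+ 2 * char_poly (mxsub h h A).
Proof.
move=> h A0 Amax; rewrite (char_poly_scalar_row A0).
rewrite (@char_poly_scalar_row _ _ (row' _ (col' _ A)) ord_max c) => [|j].
  by rewrite mulrA; congr (_ * char_poly _); apply/matrixP => i j; rewrite !mxE.
have maxE : lift ord0 ord_max = ord_max :> 'I_m.+2 by apply/val_inj.
by rewrite !mxE maxE Amax -(inj_eq (@lift_inj _ ord0)) maxE.
Qed.

(** * Convolution of periodic sequences *)

(** A correlation, which is the convolution when w is even. *)
Definition conv (R : realType) l (w f : int -> R) (x : int) : R :=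
  wsum 0 l (fun k => w k * f (x + k)).

Definition periodic (R : realType) (N : nat) (f : int -> R) : Prop :=
  forall x, f (x + N%:Z) = f x.

Definition dot (R : realType) N (f g : int -> R) : R :=
  \sum_(0 <= x < N) f x%:Z * g x%:Z.

Lemma eq_wsum (R : realType) c l (F G : int -> R) :
  F =1 G -> wsum c l F = wsum c l G.
Proof. by move=> FG; apply: eq_bigr. Qed.

Lemma wsum_opp (R : realType) l (F : int -> R) :
  wsum 0 l (fun k => F (- k)) = wsum 0 l F.
Proof.
rewrite /wsum (reindex_inj rev_ord_inj) /=; apply: eq_bigr => k _.
by congr F; have := ltn_ord k; lia.
Qed.

(** The change of variable behind associativity of convolution: a displaced
    window may replace the centred one as long as it covers the support. *)
Lemma wsum_support (R : realType) c l l' (F : int -> R) :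
  (forall k : int, (l' < `|k|)%N -> F k = 0) -> (`|c| + l' <= l)%N ->
  wsum c l F = wsum 0 l' F.
Proof.
move=> F0 le_l; rewrite /wsum.
rewrite -(big_mkord xpredT (fun k => F (c - l%:Z + k%:Z))).
rewrite -(big_mkord xpredT (fun k => F (0 - l'%:Z + k%:Z))).
pose a := absz (l%:Z - l'%:Z - c)%R.
have aE : a%:Z = l%:Z - l'%:Z - c by rewrite /a; lia.
rewrite (@big_cat_nat _ _ _ a) //=; last lia.
rewrite (@big_cat_nat _ _ _ (a + l'.*2.+1) a) /=; [|lia..].
rewrite big_nat_cond big1 ?add0r; last by move=> i Hi; apply: F0; lia.
rewrite [X in _ + X]big_nat_cond [X in _ + X]big1 ?addr0; last first.
  by move=> i Hi; apply: F0; lia.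
rewrite -{1}[a]add0n big_addn addKn; apply: eq_bigr => i _.
by congr F; lia.
Qed.

Lemma periodic_mod (R : realType) N (f : int -> R) x :
  periodic N f -> f x = f (x %% N%:Z)%Z.
Proof.
move=> perf; have perM (q : nat) y : f (y + q%:Z * N%:Z) = f y.
  elim: q => [|q IH] in y *; first by rewrite mul0r addr0.
  by rewrite -[RHS]IH -[RHS]perf; congr f; lia.
have := divz_eq x N%:Z; set q := (x %/ _)%Z; set r := (x %% _)%Z => ->.
case: (intP q) => [|p|p]; rewrite ?mul0r ?add0r // 1?addrC ?perM //.
by rewrite -[LHS](perM p.+1); congr f; lia.
Qed.

Lemma periodic_ind (R : realType) N (f g : int -> R) : (0 < N)%N ->
  periodic N f -> periodic N g ->
  (forall r, (r < N)%N -> f r%:Z = g r%:Z) -> f =1 g.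
Proof.
move=> N0 perf perg fg x; rewrite (periodic_mod x perf) (periodic_mod x perg).
have -> : (x %% N%:Z)%Z = `|(x %% N%:Z)%Z|%N%:Z.
  by rewrite gez0_abs ?modz_ge0; lia.
by apply: fg; rewrite -ltz_nat gez0_abs ?modz_ge0 ?ltz_pmod; lia.
Qed.

Lemma periodicD (R : realType) N (f : int -> R) k :
  periodic N f -> periodic N (fun x => f (x + k)).
Proof. by move=> perf x; rewrite addrAC perf. Qed.

(** For a shift by 1, the term that leaves the range equals the one that enters
    it. *)
Lemma sum_period_shift (R : realType) N (f : int -> R) k : periodic N f ->
  \sum_(0 <= x < N) f (x%:Z + k) = \sum_(0 <= x < N) f x%:Z.
Proof.
have shift1 (g : int -> R) : periodic N g ->
    \sum_(0 <= x < N) g (x%:Z + 1) = \sum_(0 <= x < N) g x%:Z.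
  move=> perg; case: N perg => [|N] perg; first by rewrite !big_geq.
  rewrite big_nat_recr // big_nat_recl //= addrC; congr (_ + _).
    by rewrite -[RHS]perg; congr g; lia.
  by apply: eq_bigr => i _; congr g; lia.
have shiftn (q : nat) (g : int -> R) : periodic N g ->
    \sum_(0 <= x < N) g (x%:Z + q%:Z) = \sum_(0 <= x < N) g x%:Z.
  move=> perg; elim: q => [|q IH]; first by under eq_bigr do rewrite addr0.
  rewrite -IH -[RHS](shift1 (fun x => g (x + q%:Z))); last exact: periodicD.
  by apply: eq_bigr => i _; congr g; lia.
move=> perf; case: k => p; first exact: shiftn.
rewrite -[LHS](shiftn p.+1 (fun x => f (x + Negz p))); last exact: periodicD.
by apply: eq_bigr => i _; congr f; lia.
Qed.

Lemma conv_periodic (R : realType) N l (w f : int -> R) :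
  periodic N f -> periodic N (conv l w f).
Proof. by move=> perf x; apply: eq_wsum => k; rewrite addrAC perf. Qed.

Lemma dot_convl (R : realType) N l (w f g : int -> R) :
  dot N (conv l w f) g = wsum 0 l (fun k => w k * dot N (fun x => f (x + k)) g).
Proof.
rewrite /dot /conv /wsum; under eq_bigr do rewrite mulr_suml.
rewrite exchange_big /=; apply: eq_bigr => k _; rewrite mulr_sumr.
by apply: eq_bigr => x _; rewrite mulrA.
Qed.

Lemma dotC (R : realType) N (f g : int -> R) : dot N f g = dot N g f.
Proof. by apply: eq_bigr => x _; rewrite mulrC. Qed.

(** Shifting f by k is adjoint to shifting g by - k, and w weighs both shifts
    equally. *)
Lemma dot_conv_adj (R : realType) N l (w f g : int -> R) :
  (forall k, w (- k) = w k) -> periodic N f -> periodic N g ->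
  dot N (conv l w f) g = dot N f (conv l w g).
Proof.
move=> symw perf perg; rewrite [RHS]dotC !dot_convl -[RHS]wsum_opp.
apply: eq_wsum => k; rewrite symw; congr (_ * _); rewrite [RHS]dotC /dot.
rewrite -[RHS](@sum_period_shift _ _ (fun x => f x * g (x - k)) k).
  by apply: eq_bigr => x _; rewrite addrK.
by move=> x; rewrite addrAC perf perg.
Qed.

(** Expand the squares: by periodicity both square terms sum to <f, f>, and
    the cross terms, averaged by w, give <w * f, f>. *)
Lemma dirichlet_form (R : realType) N l (w f : int -> R) :
  wsum 0 l w = 1 -> periodic N f ->
  wsum 0 l (fun k => w k * \sum_(0 <= x < N) (f (x%:Z + k) - f x%:Z) ^+ 2)
    = 2 * (dot N f f - dot N (conv l w f) f).
Proof.
move=> sumw perf.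
have cross k : \sum_(0 <= x < N) (f (x%:Z + k) - f x%:Z) ^+ 2 =
    2 * (dot N f f - dot N (fun x => f (x + k)) f).
  have sq := @sum_period_shift _ _ (fun x => f x * f x) k.
  have {sq} sq' : \sum_(0 <= x < N) f (x%:Z + k) * f (x%:Z + k) = dot N f f.
    by apply: sq => x; rewrite perf.
  rewrite mulrBr [2 * dot N f f]mulr_natl mulr2n -{1}sq' /dot mulr_sumr.
  rewrite -big_split -sumrB /=; apply: eq_bigr => x _; ring.
rewrite (eq_wsum _ _ (fun k => congr1 ( *%R (w k)) (cross k))) dot_convl.
(* The 1 to be expanded must not be found inside 2 = 1 + 1. *)
rewrite -[X in 2 * (X - _)]mul1r; move: 2 => c; rewrite -sumw.
rewrite /wsum mulr_suml -sumrB mulr_sumr.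
by apply: eq_bigr => k _; rewrite mulrCA mulrBr.
Qed.

Lemma dot_ge0 (R : realType) N (f : int -> R) : 0 <= dot N f f.
Proof. by apply: sumr_ge0 => x _; rewrite -expr2 sqr_ge0. Qed.

Lemma sumsq_eq0 (R : realType) N (f : nat -> R) :
  \sum_(0 <= x < N) f x ^+ 2 = 0 -> forall x, (x < N)%N -> f x = 0.
Proof.
rewrite big_mkord => /eqP; rewrite psumr_eq0 => [|x _]; last exact: sqr_ge0.
move=> /allP f0 x ltxN; apply/eqP; rewrite -sqrf_eq0.
by have /= := f0 (Ordinal ltxN) (mem_index_enum _).
Qed.

(** The two energy identities: factoring w as v * v makes a <f, f> the square
    norm of v * f, and the Dirichlet form makes (1 - a) <f, f> a sum of
    nonnegative terms. For a = 1 the term of shift 1 must vanish, which makes f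
    constant. *)
Lemma conv_eigenvalue (R : realType) N l l' (v w f : int -> R) (a : R) :
  (0 < N)%N -> (0 < l)%N -> wsum 0 l w = 1 ->
  (forall k : int, (`|k| <= l)%N -> 0 < w k) ->
  (forall k, v (- k) = v k) ->
  (forall x, conv l w f x = conv l' v (conv l' v f) x) ->
  periodic N f -> (exists x, f x != 0) ->
  (forall x, conv l w f x = a * f x) ->
  0 <= a <= 1 /\ (a = 1 -> forall x, f x = f 0).
Proof.
move=> N0 l0 sumw wpos symv sqw perf [x0 fx0] eigf.
have dot_pos : 0 < dot N f f.
  rewrite lt_neqAle dot_ge0 andbT; apply: contra_neqN fx0 => /eqP/esym dot0.
  suff -> : f =1 (fun=> 0) by [].
  apply: (periodic_ind N0 perf) => // r.
  exact: (@sumsq_eq0 R N (fun x => f x%:Z)).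
have dotw : dot N (conv l w f) f = a * dot N f f.
  by rewrite /dot mulr_sumr; apply: eq_bigr => x _; rewrite eigf mulrA.
have dotv : a * dot N f f = dot N (conv l' v f) (conv l' v f).
  rewrite -dotw -dot_conv_adj //; last exact: conv_periodic.
  by apply: eq_bigr => x _; rewrite sqw.
have a_ge0 : 0 <= a by rewrite -(pmulr_lge0 _ dot_pos) dotv dot_ge0.
have := dirichlet_form sumw perf; rewrite dotw -{1}[dot N f f]mul1r -mulrBl.
set E := wsum _ _ _ => EE.
have term_ge0 (k : int) : (`|k| <= l)%N ->
    0 <= w k * \sum_(0 <= x < N) (f (x%:Z + k) - f x%:Z) ^+ 2.
  move=> lek; apply: mulr_ge0; first exact/ltW/wpos.
  by apply: sumr_ge0 => x _; apply: sqr_ge0.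
have E_ge0 : 0 <= E.
  by apply: sumr_ge0 => k _; apply: term_ge0; have := ltn_ord k; lia.
have a_le1 : a <= 1.
  by move: E_ge0; rewrite EE pmulr_rge0 // pmulr_lge0 // subr_ge0.
split=> [|a1]; first by rewrite a_ge0.
have step : (fun x => f (x + 1)) =1 f.
  have /eqP := EE; rewrite a1 subrr mul0r mulr0 psumr_eq0; last first.
    by move=> k _; apply: term_ge0; have := ltn_ord k; lia.
  (* Position l + 1 of the window -l, ..., l is the shift by 1. *)
  have ltl : (l.+1 < l.*2.+1)%N by lia.
  move=> /allP/(_ (Ordinal ltl) (mem_index_enum _)) /=.
  rewrite (_ : 0 - l%:Z + l.+1%:Z = 1); last lia.
  rewrite mulf_eq0 gt_eqF ?wpos //= => /eqP/sumsq_eq0 step0.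
  apply: (periodic_ind N0 _ perf); first exact: periodicD.
  by move=> r /step0/eqP; rewrite subr_eq0 => /eqP.
(* Invariance under the shift by 1 is 1-periodicity. *)
move=> x; rewrite (@periodic_mod _ 1 f x) ?modz1 //.
Qed.

Lemma conv_self_conv (R : realType) l l' (v w f : int -> R) x :
  (forall k : int, (l' < `|k|)%N -> v k = 0) -> (l'.*2 <= l)%N ->
  (forall k, w k = self_conv l' v k) ->
  conv l w f x = conv l' v (conv l' v f) x.
Proof.
move=> v0 le_l wv; rewrite /conv {1}/wsum.
under eq_bigr do rewrite wv /self_conv {1}/wsum mulr_suml.
rewrite exchange_big; apply: eq_bigr => j _ /=.
set j' := 0 - l'%:Z + j%:Z.
have lej : (`|- j'| <= l')%N by have := ltn_ord j; lia.
rewrite -(@wsum_support _ (- j') l l'); last lia; last first.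
  by move=> k /v0 ->; rewrite mul0r.
rewrite /wsum mulr_sumr; apply: eq_bigr => k _; rewrite -mulrA.
by congr (_ * (v _ * f _)); lia.
Qed.

(** * Unrolling a signal to a periodic sequence *)

Lemma conv_reflect (R : realType) l (w f : int -> R) c e x :
  (forall k, w (- k) = w k) -> (forall y, f (c - y) = e * f y) ->
  conv l w f (c - x) = e * conv l w f x.
Proof.
move=> symw symf; rewrite /conv -wsum_opp /wsum mulr_sumr.
apply: eq_bigr => k _; rewrite symw mulrCA -symf; congr (_ * f _); lia.
Qed.

(** Averaging by an even filter fixes the value at a centre of odd symmetry:
    the deviations from f x at the positions x + k and x - k cancel. *)
Lemma conv_point_reflect (R : realType) l (w f : int -> R) x :
  wsum 0 l w = 1 -> (forall k, w (- k) = w k) ->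
  (forall k : int, (`|k| <= l)%N -> f (x - k) = 2 * f x - f (x + k)) ->
  conv l w f x = f x.
Proof.
move=> sumw symw symf.
have : conv l w f x = 2 * f x - conv l w f x.
  (* As 2 = 1 + 1, it is abstracted before 1 is expanded as the sum of w. *)
  rewrite {1}/conv -wsum_opp -[X in X - _]mulr1; move: 2 symf => c symf.
  rewrite -sumw /conv /wsum mulr_sumr -sumrB; apply: eq_bigr => k _.
  by rewrite symw symf; [ring|have := ltn_ord k; lia].
lra.
Qed.

Lemma filter_even (R : realType) n l (w : int -> R) k :
  is_filter n l w -> symmetric_filter l w -> w (- k) = w k.
Proof.
case=> _ _ _ w0 _ symw; have [lek|ltk] := leqP `|k|%N l; last first.
  by rewrite !w0 ?abszN.
have [->|k0] := eqVneq k 0; first by rewrite oppr0.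
have e : w (- (`|k|%N)%:Z) = w `|k|%N%:Z by apply: symw; lia.
have [kp|kn] := leP 0 k; first by rewrite gez0_abs // in e.
by move: e; rewrite ltz0_abs // opprK => ->.
Qed.

Lemma entry_ord (R : realType) n (s : 'cV[R]_n) (i : 'I_n) : entry s i = s i 0.
Proof. by rewrite /entry valK. Qed.

Lemma entryZ (R : realType) n a (s : 'cV[R]_n) k :
  entry (a *: s) k = a * entry s k.
Proof. by rewrite /entry; case: insub => [i|] /=; rewrite ?mxE ?mulr0. Qed.

Definition ext_period bc n :=
  match bc with
  | Periodic => n
  | Reflective => n.*2
  | AntiReflective => n.-1.*2
  end.

(** A residue r in [0, n) addresses a sample directly; the remaining residues,
    absent in the periodic case, address the reflected copy of the signal. *)
Definition unroll (R : realType) bc n (s : 'cV[R]_n) (x : int) : R :=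
  let N := ext_period bc n in
  let r := absz (x %% N%:Z)%Z in
  if (r < n)%N then entry s r
  else if bc is AntiReflective then - entry s (N - r) else entry s (N.-1 - r).

(** The anti-reflection s_{-j} = 2 s_0 - s_j is a plain odd reflection only
    when the end samples vanish. *)
Definition zero_ends (R : realType) bc n (s : 'cV[R]_n) : Prop :=
  bc = AntiReflective -> entry s 0 = 0 /\ entry s n.-1 = 0.

Lemma unroll_periodic (R : realType) bc n (s : 'cV[R]_n) :
  periodic (ext_period bc n) (unroll bc s).
Proof. by move=> x; rewrite /unroll modzDr. Qed.

Lemma unroll_small (R : realType) bc n (s : 'cV[R]_n) r :
  (r < ext_period bc n)%N ->
  unroll bc s r%:Z = if (r < n)%N then entry s r
    else if bc is AntiReflective then - entry s (ext_period bc n - r)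
    else entry s ((ext_period bc n).-1 - r).
Proof. by move=> ltr; rewrite /unroll modz_nat absz_nat modn_small. Qed.

Lemma unrollZ (R : realType) bc n a (s : 'cV[R]_n) x :
  unroll bc (a *: s) x = a * unroll bc s x.
Proof.
by rewrite /unroll !entryZ; case: ifP => // _; case: bc; rewrite ?mulrN.
Qed.

Lemma unroll_inside (R : realType) bc n (s : 'cV[R]_n) r :
  (2 < n)%N -> (r < n)%N -> unroll bc s r%:Z = entry s r.
Proof. by move=> n2 ltr; rewrite unroll_small ?ltr //; case: bc => /=; lia. Qed.

(** In the two reflecting cases the unrolled signal satisfies f (c - x) = e f x
    with e its [parity] and c twice the centre of the reflection at the right
    end: n - 1/2 in the reflective case, n - 1 in the anti-reflective case. *)
Definition center bc n : int :=
  if bc is Reflective then (ext_period bc n)%:Z - 1 else (ext_period bc n)%:Z.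

Definition parity (R : realType) bc : R :=
  if bc is AntiReflective then -1 else 1.

Lemma unroll_reflect (R : realType) bc n (s : 'cV[R]_n) x :
  (2 < n)%N -> bc <> Periodic -> zero_ends bc s ->
  unroll bc s (center bc n - x) = parity R bc * unroll bc s x.
Proof.
move=> n2 nper ends; move: x; apply: (@periodic_ind _ (ext_period bc n)).
- by case: bc {nper ends} => /=; lia.
- by move=> x; rewrite opprD addrA -unroll_periodic subrK.
- by move=> x; rewrite unroll_periodic.
move=> r ltr; case: bc nper ends ltr => //= _ ends ltr.
- rewrite mul1r (_ : _ - _ = (n.*2.-1 - r)%N%:Z); last lia.
  rewrite !unroll_small /=; [|lia..].
  by case: ifP; case: ifP => //; try lia; move=> *; congr entry; lia.
- have [s0 smax] := ends erefl; rewrite mulN1r.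
  have [->|r0] := posnP r.
    rewrite subr0 -[X in unroll _ _ X]add0r unroll_periodic.
    by rewrite unroll_inside ?s0 ?oppr0 //; lia.
  rewrite (_ : _ - _ = (n.-1.*2 - r)%N%:Z); last lia.
  rewrite !unroll_small /=; [|lia..].
  case: ifP; case: ifP => ? ?; try lia.
  + have -> : r = n.-1 by lia.
    have -> : (n.-1.*2 - n.-1 = n.-1)%N by lia.
    lra.
  + by rewrite opprK.
  + by congr (- entry s _); lia.
Qed.

Lemma extend_unroll (R : realType) bc n (s : 'cV[R]_n) l x :
  (2 < n)%N -> (l <= n.-1 %/ 2)%N -> zero_ends bc s ->
  - l%:Z <= x <= n%:Z - 1 + l%:Z -> extend bc s x = unroll bc s x.
Proof.
move=> n2 lel ends xlr.
have len : (l.*2 < n)%N by lia.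
case: x xlr => p xlr /=.
  case: ifP => ltp; first by rewrite unroll_inside.
  case: bc ends => ends.
  - rewrite (_ : Posz p = (p - n)%N%:Z + (ext_period Periodic n)%:Z) /=;
      last lia.
    by rewrite unroll_periodic unroll_inside //; [congr entry|]; lia.
  - by rewrite unroll_small /= ?ltp; [congr entry|]; lia.
  - have [s0 smax] := ends erefl.
    rewrite unroll_small /= ?ltp; last lia.
    by rewrite smax mulr0 sub0r; congr (- entry s _); lia.
rewrite -unroll_periodic; set N := ext_period bc n.
have ltN : (p.+1 + n <= N + l)%N by rewrite /N; case: bc {ends N} => /=; lia.
rewrite (_ : Negz p + _ = (N - p.+1)%N%:Z); last lia.
rewrite unroll_small -/N; last lia.
rewrite /N; case: bc ends @N ltN => ends /= ltN.
- by rewrite ifT //; lia.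
- by rewrite ifF; [congr entry|]; lia.
- have [s0 _] := ends erefl.
  by rewrite ifF ?s0 ?mulr0 ?sub0r; [congr (- entry s _)|]; lia.
Qed.

Lemma filter_mapE (R : realType) bc n l (w : int -> R) (s : 'cV[R]_n) i :
  (forall k, w (- k) = w k) ->
  Defs.filter_map bc l w s i 0 = conv l w (extend bc s) i%:Z.
Proof.
move=> symw; rewrite mxE /conv /wsum; apply: eq_bigr => k _.
have -> : i%:Z + (0 - l%:Z + k%:Z) = i%:Z - l%:Z + k%:Z by lia.
congr (_ * _); set x := _ + k%:Z.
have [le0|lt0] := leP 0 (i%:Z - x).
  by rewrite gez0_abs // -symw; congr w; rewrite /x; lia.
by rewrite ltz0_abs //; congr w; rewrite /x; lia.
Qed.

(** * The structured matrix as a convolution *)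

Lemma filter_map_unroll (R : realType) bc n l (w : int -> R) (s : 'cV[R]_n) i :
  (forall k, w (- k) = w k) -> (2 < n)%N -> (l <= n.-1 %/ 2)%N ->
  zero_ends bc s -> (i < n)%N ->
  entry (Defs.filter_map bc l w s) i = conv l w (unroll bc s) i%:Z.
Proof.
move=> symw n2 lel ends ltin.
rewrite (entry_ord _ (Ordinal ltin)) filter_mapE //; apply: eq_bigr => k _.
congr (_ * _); apply: (@extend_unroll _ _ _ _ l) => //=.
by have := ltn_ord k; lia.
Qed.

(** Anti-reflection is an odd symmetry about each end sample, so filtering
    does not change the end samples. *)
Lemma filter_map_end (R : realType) n l (w : int -> R) (s : 'cV[R]_n) i :
  (forall k, w (- k) = w k) -> wsum 0 l w = 1 ->
  (2 < n)%N -> (l <= n.-1 %/ 2)%N -> i = 0%N \/ i = n.-1 ->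
  entry (Defs.filter_map AntiReflective l w s) i = entry s i.
Proof.
move=> symw sumw n2 lel iend; have ltin : (i < n)%N by lia.
have len : (l.*2 < n)%N by lia.
pose f := extend AntiReflective s.
have f_in p : (p < n)%N -> f p%:Z = entry s p by move=> ltp; rewrite /f /= ltp.
have f_lo p : (p <= l)%N -> f (- p%:Z) = 2 * entry s 0 - entry s p.
  by case: p => [|p] lep; rewrite ?NegzE // oppr0 f_in; [ring|lia].
have f_hi p : (p <= l)%N ->
    f (n.-1 + p)%N%:Z = 2 * entry s n.-1 - entry s (n.-1 - p).
  case: p => [|p] lep; first by rewrite addn0 subn0 f_in; [ring|lia].
  by rewrite /f /= ifF ?addKn //; lia.
rewrite (entry_ord _ (Ordinal ltin)) filter_mapE // conv_point_reflect //;
  rewrite -/f.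
  by rewrite f_in.
move=> k lek; rewrite f_in //=.
case: iend => [i0|iN]; case: k lek => p lep; rewrite ?i0 ?iN.
- by rewrite sub0r add0r f_lo // f_in //; lia.
- rewrite sub0r add0r NegzE opprK f_lo // f_in; [ring|lia].
- rewrite (_ : _ - Posz p = (n.-1 - p)%N%:Z); last lia.
  rewrite (_ : _ + Posz p = (n.-1 + p)%N%:Z); last lia.
  by rewrite f_hi // f_in; [ring|lia].
- rewrite (_ : _ - Negz p = (n.-1 + p.+1)%N%:Z); last lia.
  rewrite (_ : _ + Negz p = (n.-1 - p.+1)%N%:Z); last lia.
  by rewrite f_hi // f_in //; lia.
Qed.

Lemma filter_map_ends (R : realType) bc n l (w : int -> R) (s : 'cV[R]_n) :
  (forall k, w (- k) = w k) -> wsum 0 l w = 1 ->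
  (2 < n)%N -> (l <= n.-1 %/ 2)%N ->
  zero_ends bc s -> zero_ends bc (Defs.filter_map bc l w s).
Proof.
move=> symw sumw n2 lel ends bcE; rewrite bcE in ends *.
by rewrite !filter_map_end; auto.
Qed.

(** Both sides are periodic and agree on the samples 0, ..., n - 1; the rest of
    the period follows since both have the same reflection symmetry. *)
Lemma unroll_filter_map (R : realType) bc n l (w : int -> R) (s : 'cV[R]_n) :
  (forall k, w (- k) = w k) -> wsum 0 l w = 1 ->
  (2 < n)%N -> (l <= n.-1 %/ 2)%N -> zero_ends bc s ->
  unroll bc (Defs.filter_map bc l w s) =1 conv l w (unroll bc s).
Proof.
move=> symw sumw n2 lel ends; set t := Defs.filter_map _ _ _ _.
have tE i : (i < n)%N -> unroll bc t i%:Z = conv l w (unroll bc s) i%:Z.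
  by move=> ltin; rewrite unroll_inside // filter_map_unroll.
have endt : zero_ends bc t by apply: filter_map_ends.
apply: (@periodic_ind _ (ext_period bc n)).
- by case: bc {t tE endt ends} => /=; lia.
- exact: unroll_periodic.
- exact/conv_periodic/unroll_periodic.
move=> r ltr; have [/tE //|le_nr] := ltnP r n.
have nper : bc <> Periodic by move=> bcE; move: ltr; rewrite bcE /=; lia.
have cE : center bc n - (center bc n - r%:Z) = r%:Z by lia.
rewrite -cE unroll_reflect // (@conv_reflect _ _ _ _ _ (parity R bc)) //;
  last first.
  by move=> y; apply: unroll_reflect.
have [i ltin ->] : exists2 i, (i < n)%N & center bc n - r%:Z = i%:Z.
  exists (absz (center bc n - r%:Z)).
    by case: bc {t tE endt ends cE} nper ltr => //= _ ltr; lia.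
  rewrite gez0_abs //.
  by case: bc {t tE endt ends cE} nper ltr => //= _ ltr; lia.
by rewrite tE.
Qed.

(** The reflection identifies the two halves of the period. *)
Lemma sum_fold (R : realType) n (h : nat -> R) :
  (forall x, (x < n)%N -> h (n.*2.-1 - x)%N = h x) ->
  \sum_(0 <= x < n.*2) h x = 2 * \sum_(0 <= x < n) h x.
Proof.
move=> symh; rewrite (@big_cat_nat _ _ _ n) //=; last lia.
rewrite mulr_natl mulr2n; congr (_ + _).
rewrite big_nat_rev -{1}[n]add0n big_addn (_ : (n.*2 - n)%N = n); last lia.
rewrite big_nat [RHS]big_nat; apply: eq_bigr => x ltx.
by rewrite -[RHS]symh; [congr h|]; lia.
Qed.

(** Here the reflection fixes the two positions 0 and n - 1, where h
    vanishes, so each of the other values is counted twice. *)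
Lemma sum_fold_ends (R : realType) n (h : nat -> R) : (0 < n)%N ->
  h 0%N = 0 -> h n.-1 = 0 ->
  (forall x, (0 < x < n)%N -> h (n.-1.*2 - x)%N = h x) ->
  \sum_(0 <= x < n.-1.*2) h x = 2 * \sum_(0 <= x < n) h x.
Proof.
case: n => //= n _ h0 hn symh; rewrite (@big_cat_nat _ _ _ n) //=; last lia.
rewrite mulr_natl mulr2n big_nat_recr //= hn addr0; congr (_ + _).
rewrite big_nat_rev -{1}[n]add0n big_addn (_ : (n.*2 - n)%N = n); last lia.
have -> : \sum_(0 <= x < n) h x = \sum_(0 <= x < n) h x.+1.
  transitivity (\sum_(0 <= x < n.+1) h x).
    by rewrite big_nat_recr //= hn addr0.
  by rewrite big_nat_recl // h0 add0r.
rewrite big_nat [RHS]big_nat; apply: eq_bigr => x ltx.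
by rewrite -[RHS]symh; [congr h|]; lia.
Qed.

Lemma dot_unroll (R : realType) bc n (s t : 'cV[R]_n) :
  (2 < n)%N -> zero_ends bc s -> zero_ends bc t ->
  dot (ext_period bc n) (unroll bc s) (unroll bc t)
    = (if bc is Periodic then 1 else 2) * (s^T *m t) 0 0.
Proof.
move=> n2 ends endt.
have -> : (s^T *m t) 0 0 =
    \sum_(0 <= x < n) unroll bc s x%:Z * unroll bc t x%:Z.
  rewrite mxE big_mkord; apply: eq_bigr => i _.
  by rewrite !unroll_inside // !entry_ord mxE.
have prod_reflect (x : int) : bc <> Periodic ->
    unroll bc s (center bc n - x) * unroll bc t (center bc n - x) =
    unroll bc s x * unroll bc t x.
  move=> nper; rewrite !unroll_reflect // mulrACA.
  by rewrite /parity; case: bc {ends endt nper}; rewrite ?mulrNN !mul1r.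
rewrite /dot; case: bc ends endt prod_reflect => /= ends endt prod_reflect.
- by rewrite mul1r.
- apply: sum_fold => x ltx; rewrite -[RHS]prod_reflect //.
  by congr (_ * _); congr (unroll _ _); lia.
- have [s0 smax] := ends erefl.
  apply: sum_fold_ends; rewrite ?unroll_inside ?s0 ?smax ?mul0r //; try lia.
  move=> x ltx; rewrite -[RHS]prod_reflect //.
  by congr (_ * _); congr (unroll _ _); lia.
Qed.

(** Self-adjointness of the convolution of unrolled signals. The bilinear form
    of the matrix is thus symmetric, in the anti-reflective case only on the
    signals vanishing at both ends. *)
Lemma structured_mx_adj (R : realType) bc n l (w : int -> R) (s t : 'cV[R]_n) :
  (forall k, w (- k) = w k) -> wsum 0 l w = 1 ->
  (2 < n)%N -> (l <= n.-1 %/ 2)%N -> zero_ends bc s -> zero_ends bc t ->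
  s^T *m structured_mx n bc l w *m t = t^T *m structured_mx n bc l w *m s.
Proof.
move=> symw sumw n2 lel ends endt; rewrite -!mulmxA !structured_mxE.
apply/matrixP => i j; rewrite !ord1 {i j}.
have c0 : (if bc is Periodic then 1 else 2) != 0 :> R.
  by case: bc {ends endt}; rewrite ?oner_eq0 ?pnatr_eq0.
apply: (mulfI c0); rewrite -!dot_unroll //; try exact: filter_map_ends.
have dotE (u u' : 'cV[R]_n) : zero_ends bc u' ->
    dot (ext_period bc n) (unroll bc u) (unroll bc (Defs.filter_map bc l w u'))
    = dot (ext_period bc n) (conv l w (unroll bc u')) (unroll bc u).
  move=> endu; rewrite dotC; apply: eq_bigr => x _.
  by rewrite unroll_filter_map.
rewrite !dotE // dot_conv_adj //; try exact: unroll_periodic.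
exact: dotC.
Qed.

Lemma structured_mx_eigen (R : realType) bc n l l' (v w : int -> R)
    (s : 'cV[R]_n) a :
  (2 < n)%N -> is_filter n l w -> symmetric_filter l w ->
  is_filter n l' v -> symmetric_filter l' v -> (l'.*2 <= l)%N ->
  (forall k, w k = self_conv l' v k) ->
  zero_ends bc s -> s != 0 -> structured_mx n bc l w *m s = a *: s ->
  0 <= a <= 1 /\ (a = 1 -> forall x, unroll bc s x = unroll bc s 0).
Proof.
move=> n2 fw symw fv symv le_l wv ends s0 eigs.
have evenw k : w (- k) = w k by apply: filter_even fw symw.
have evenv k : v (- k) = v k by apply: filter_even fv symv.
case: fw fv => l0 lel wpos _ sumw [_ _ _ v0 _].
apply: (@conv_eigenvalue _ (ext_period bc n) l l' v w) => //.
- by case: bc {ends eigs} => /=; lia.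
- by move=> x; apply: conv_self_conv.
- exact: unroll_periodic.
- have /cV0Pn[i si] := s0.
  by exists i%:Z; rewrite unroll_inside // entry_ord.
by move=> x; rewrite -unroll_filter_map // -structured_mxE eigs unrollZ.
Qed.

(** The coefficient of v * v at 2l' is at least v_l' ^ 2 > 0. *)
Lemma self_conv_length (R : realType) n l l' (v w : int -> R) :
  is_filter n l' v -> is_filter n l w ->
  (forall k, w k = self_conv l' v k) -> (l'.*2 <= l)%N.
Proof.
case=> _ _ vpos v0 _ [_ _ _ w0 _] wv; rewrite leqNgt; apply/negP => ltl.
have v_ge0 k : 0 <= v k.
  by have [/vpos/ltW //|/v0 ->] := leqP `|k|%N l'.
have : 0 < w l'.*2%:Z.
  have lt2 : (l'.*2 < l'.*2.+1)%N by [].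
  rewrite wv /self_conv /wsum (bigD1 (Ordinal lt2)) //=.
  apply: ltr_wpDr; first by apply: sumr_ge0 => k _; apply: mulr_ge0.
  by apply: mulr_gt0; apply: vpos; lia.
by rewrite w0 ?ltxx //; lia.
Qed.

(** * The spectrum *)

Lemma conv_const (R : realType) l (w : int -> R) c x :
  wsum 0 l w = 1 -> conv l w (fun=> c) x = c.
Proof.
by move=> sumw; rewrite /conv /wsum -mulr_suml -/(wsum 0 l w) sumw mul1r.
Qed.

Lemma zero_ends_delta (R : realType) bc n (i : 'I_n) :
  (bc = AntiReflective -> 0 < i < n.-1)%N ->
  zero_ends bc (delta_mx i 0 : 'cV[R]_n).
Proof.
move=> iin bcE; have {iin bcE} lti := iin bcE; have ltin := ltn_ord i.
have out (k : nat) : k != i -> entry (delta_mx i 0 : 'cV[R]_n) k = 0.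
  rewrite /entry; case: insubP => //= j _ jk nki.
  by rewrite mxE -(inj_eq val_inj) /= jk (negPf nki).
by split; apply: out; lia.
Qed.

(** The anti-reflective extension also reads the end samples when filtering an
    inner one, while the end rows are unit rows: there the symmetry is confined
    to the inner block. *)
Lemma structured_mx_sym (R : realType) bc n l (w : int -> R) (i j : 'I_n) :
  (forall k, w (- k) = w k) -> wsum 0 l w = 1 ->
  (2 < n)%N -> (l <= n.-1 %/ 2)%N ->
  (bc = AntiReflective -> 0 < i < n.-1)%N ->
  (bc = AntiReflective -> 0 < j < n.-1)%N ->
  structured_mx n bc l w i j = structured_mx n bc l w j i.
Proof.
move=> symw sumw n2 lel iin jin.
have := structured_mx_adj symw sumw n2 lel (@zero_ends_delta R bc n i iin)
  (@zero_ends_delta R bc n j jin).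
move/matrixP/(_ 0 0); rewrite !trmx_delta -!rowE.
by rewrite -!colE !mxE.
Qed.

Lemma root_prodP (F : idomainType) (I : finType) (d : I -> F) a :
  reflect (exists i, d i = a) (root (\prod_i ('X - (d i)%:P)) a).
Proof.
rewrite -(big_map d xpredT (fun b => 'X - b%:P)) root_prod_XsubC.
apply: (iffP mapP) => [[i _ ->]|[i <-]]; first by exists i.
by exists i; rewrite ?mem_index_enum.
Qed.

Lemma unroll_const (R : realType) bc n (c : R) x :
  (2 < n)%N -> bc <> AntiReflective ->
  unroll bc (const_mx c : 'cV[R]_n) x = c.
Proof.
move=> n2 nAR; move: x; apply: (@periodic_ind _ (ext_period bc n)).
- by case: bc {nAR} => /=; lia.
- exact: unroll_periodic.
- by [].
have entryc k : (k < n)%N -> entry (const_mx c : 'cV[R]_n) k = c.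
  by move=> ltkn; rewrite (entry_ord _ (Ordinal ltkn)) mxE.
move=> r ltr; rewrite unroll_small //; case: ifP => [/entryc //|nltr].
by case: bc nAR ltr => //= _ ltr; rewrite entryc //; lia.
Qed.

Lemma structured_mx_const (R : realType) bc n l (w : int -> R) :
  (forall k, w (- k) = w k) -> wsum 0 l w = 1 ->
  (2 < n)%N -> (l <= n.-1 %/ 2)%N -> bc <> AntiReflective ->
  structured_mx n bc l w *m const_mx 1 = const_mx 1 :> 'cV[R]_n.
Proof.
move=> symw sumw n2 lel nAR; rewrite structured_mxE.
apply/colP => i; rewrite -entry_ord filter_map_unroll //.
rewrite mxE -[RHS](conv_const 1 i%:Z sumw); apply: eq_wsum => k.
by rewrite unroll_const.
Qed.

(** Eigenvectors for the eigenvalue 1 unroll to constant sequences, so the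
    eigenspace is a line; by diagonalisability 1 is a simple root, moved to
    index 0 by a transposition. *)
Lemma simple_top_spectrum (R : realType) bc n l l' (v w : int -> R) :
  (2 < n)%N -> is_filter n l w -> symmetric_filter l w ->
  is_filter n l' v -> symmetric_filter l' v ->
  (forall k, w k = self_conv l' v k) -> bc <> AntiReflective ->
  exists2 d : 'I_n -> R,
    char_poly (structured_mx n bc l w) = \prod_i ('X - (d i)%:P)
    & forall i : 'I_n, (i = 0%N :> nat -> d i = 1) /\
                       ((1 <= i)%N -> 0 <= d i < 1).
Proof.
move=> n2 fw symw fv symv wv nAR; set W := structured_mx _ _ _ _.
have le_l := self_conv_length fv fw wv.
have evenw k : w (- k) = w k by apply: filter_even fw symw.
have [_ lel _ _ sumw] := fw.
have ends (s : 'cV[R]_n) : zero_ends bc s by move=> /nAR.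
have symW : W^T = W.
  by apply/matrixP => i j; rewrite mxE; apply: structured_mx_sym => // /nAR.
have [d charW multW] := symmetric_spectrum symW.
have eigW (u : 'rV[R]_n) a : u != 0 -> u *m W = a *: u ->
    0 <= a <= 1 /\ (a = 1 -> u = u 0 (Ordinal (ltnW (ltnW n2))) *: const_mx 1).
  move=> u0 eigu; have eiguT : W *m u^T = a *: u^T.
    by rewrite -{1}symW -trmx_mul eigu linearZ.
  have uT0 : u^T != 0 by rewrite trmx_eq0.
  have [a01 uconst] :=
    structured_mx_eigen n2 fw symw fv symv le_l wv (ends u^T) uT0 eiguT.
  split=> // /uconst {}uconst; apply/rowP => i; rewrite !mxE mulr1.
  have := uconst i%:Z; rewrite -[0%R]/(Posz 0) !unroll_inside //; last lia.
  rewrite entry_ord -[X in entry _ X]/(val (Ordinal (ltnW (ltnW n2)))).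
  by rewrite entry_ord !mxE.
have d01 i : 0 <= d i <= 1.
  have : root (char_poly W) (d i) by rewrite charW; apply/root_prodP; exists i.
  rewrite -eigenvalue_root_char => /eigenvalueP[u eigu u0].
  by have [] := eigW u _ u0 eigu.
have [i0 di0] : exists i, d i = 1.
  apply/root_prodP; rewrite -charW -eigenvalue_root_char.
  apply/eigenvalueP; exists (const_mx 1).
    rewrite scale1r -[const_mx 1]trmxK -{1}symW -trmx_mul trmx_const.
    by rewrite structured_mx_const.
  apply/rowV0Pn; exists (const_mx 1); rewrite ?submx_refl //.
  apply/eqP => /rowP/(_ (Ordinal (ltnW (ltnW n2))))/eqP.
  by rewrite !mxE oner_eq0.
have uniq1 i : d i = 1 -> i = i0.
  move=> di; have le1 : (#|[set i | d i == 1%R]| <= 1)%N.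
    apply: leq_trans (multW 1) _.
    apply: leq_trans (rank_leq_row (const_mx 1 : 'rV[R]_n)).
    apply/mxrankS/row_subP => k; set u := row k _.
    have eigu : u *m W = 1 *: u by apply/eigenspaceP/row_sub.
    have [->|u0] := eqVneq u 0; first exact: sub0mx.
    have [_ /(_ erefl) ->] := eigW u 1 u0 eigu.
    exact/scalemx_sub/submx_refl.
  by apply: (card_le1_eqP le1); rewrite inE ?di ?di0.
pose z := Ordinal (ltnW (ltnW n2)).
exists (fun i => d (tperm z i0 i)).
  rewrite charW (reindex_inj (@perm_inj _ (tperm z i0))) /=.
  by apply: eq_bigr.
move=> i; split=> [i_0|i_gt0].
  by rewrite (_ : i = z) ?tpermL //; apply: val_inj.
have /andP[-> /=] := d01 (tperm z i0 i); rewrite le_eqVlt => /predU1P[|//].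
move/uniq1/(canRL (tpermK z i0)); rewrite tpermR => iz.
by rewrite iz in i_gt0.
Qed.

(** The end rows are unit rows, so deleting them leaves the inner block M. An
    eigenvector of M, padded by zeros at both ends, is an eigenvector of W, as
    filtering keeps the end samples at 0; if its eigenvalue were 1, it would
    unroll to a constant, equal to its first sample 0. *)
Lemma anti_reflective_spectrum (R : realType) m l l' (v w : int -> R) :
  let n := m.+2 in
  (2 < n)%N -> is_filter n l w -> symmetric_filter l w ->
  is_filter n l' v -> symmetric_filter l' v ->
  (forall k, w k = self_conv l' v k) ->
  exists2 d : 'I_m -> R,
    char_poly (structured_mx n AntiReflective l w)
      = ('X - 1%:P) ^+ 2 * \prod_i ('X - (d i)%:P)
    & forall i, 0 <= d i < 1.
Proof.
move=> n n2 fw symw fv symv wv; set W := structured_mx _ _ _ _.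
have le_l := self_conv_length fv fw wv.
have evenw k : w (- k) = w k by apply: filter_even fw symw.
have [_ lel _ _ sumw] := fw.
have end_row (s : 'cV[R]_n) (i : 'I_n) : i = 0%N :> nat \/ i = n.-1 :> nat ->
    (W *m s) i 0 = s i 0.
  by move=> iend; rewrite structured_mxE -!entry_ord filter_map_end.
have end_rowE (i : 'I_n) : i = 0%N :> nat \/ i = n.-1 :> nat ->
    forall j, W i j = 1 *+ (i == j).
  move=> iend j; have := end_row (delta_mx j 0) i iend.
  by rewrite -colE !mxE andbT => ->; rewrite mulrb.
rewrite (char_poly_scalar_ends (c := 1)); first last.
- by apply: end_rowE; right.
- by apply: end_rowE; left.
set h := fun i => lift ord0 _; set M := mxsub h h W.
have hE i : h i = i.+1 :> nat.
  by rewrite /= /bump /= leqNgt ltn_ord.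
have injh : injective h by move=> i j /lift_inj/lift_inj.
have symM : M^T = M.
  apply/matrixP => i j; rewrite mxE [LHS]mxE [RHS]mxE.
  apply: structured_mx_sym => // _.
    by rewrite hE /= ltnS ltn_ord.
  by rewrite hE /= ltnS ltn_ord.
have [d charM _] := symmetric_spectrum symM.
exists d; first by rewrite charM.
move=> i; have : root (char_poly M) (d i).
  by rewrite charM; apply/root_prodP; exists i.
rewrite -eigenvalue_root_char => /eigenvalueP[u eigu u0].
pose P : 'M[R]_(m, n) := rowsub h 1%:M.
pose s := P^T *m u^T.
have s_in j : s (h j) 0 = u 0 j.
  rewrite mxE (bigD1 j) //= !mxE eqxx mul1r big1 ?addr0 // => k nkj.
  by rewrite !mxE (inj_eq injh) (negPf nkj) mul0r.
have s_end k : k = 0%N \/ k = n.-1 -> entry s k = 0.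
  move=> kend; have ltk : (k < n)%N by rewrite /n in kend *; lia.
  rewrite (entry_ord _ (Ordinal ltk)) mxE big1 // => j _.
  rewrite !mxE -(inj_eq val_inj) [val (h j)]hE /=.
  rewrite (_ : _ == _ = false) ?mul0r //.
  by have := ltn_ord j; rewrite /n in kend *; lia.
have ends : zero_ends AntiReflective s by move=> _; split; apply: s_end; auto.
have endWs : zero_ends AntiReflective (W *m s).
  by rewrite structured_mxE; apply: filter_map_ends.
have eigs : W *m s = d i *: s.
  have PWs : P *m (W *m s) = d i *: u^T.
    rewrite !mulmxA (_ : P *m W *m P^T = M^T).
      by rewrite -trmx_mul eigu linearZ.
    apply/matrixP => j k; rewrite symM mxE -rowsubE mxE (bigD1 (h k)) //=.
    rewrite !mxE eqxx mulr1 big1 ?addr0 // => x nx.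
    by rewrite !mxE eq_sym (negPf nx) mulr0.
  apply/colP => x; have [[x0|xN]|xin] :
      (x = 0%N :> nat \/ x = n.-1 :> nat) \/ (0 < x < n.-1)%N.
  - by have := ltn_ord x; move: (nat_of_ord x) => y; rewrite /n; lia.
  - by rewrite -[LHS]entry_ord -[RHS]entry_ord entryZ x0 s_end ?mulr0; auto;
      have [] := endWs erefl.
  - by rewrite -[LHS]entry_ord -[RHS]entry_ord entryZ xN s_end ?mulr0; auto;
      have [] := endWs erefl.
  have ltx : (x.-1 < m)%N.
    by move: xin; move: (nat_of_ord x) => y; rewrite /n; lia.
  have -> : x = h (Ordinal ltx).
    by apply: val_inj; rewrite [RHS]hE /= prednK //; case/andP: xin.
  have /colP/(_ (Ordinal ltx)) := PWs.
  rewrite -rowsubE [X in X = _ -> _]mxE => ->.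
  by rewrite [LHS]mxE [RHS]mxE s_in mxE.
have s0 : s != 0.
  have /rV0Pn[j uj] := u0.
  by apply/cV0Pn; exists (h j); rewrite s_in.
have [/andP[-> le1] const1] :=
  structured_mx_eigen n2 fw symw fv symv le_l wv ends s0 eigs.
rewrite lt_neqAle le1 andbT /=; apply: contraNneq s0 => /const1 s_const.
apply/eqP/colP => x; rewrite [RHS]mxE -entry_ord.
rewrite -(unroll_inside AntiReflective s n2 (ltn_ord x)) s_const.
rewrite -[X in unroll _ _ X]/(Posz 0) unroll_inside //.
by apply: s_end; left.
Qed.

Theorem theorem1 (R : realType) (n l' l : nat) (s : 'cV[R]_n)
    (v w : int -> R) (bc : boundary)
    (hv : is_filter n l' v) (hvsym : symmetric_filter l' v)
    (hvdec : decreasing_filter v)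
    (hl' : (0 < l' <= n.-1 %/ 4)%N)
    (hwv : forall k : int, w k = self_conv l' v k)
    (hw : is_filter n l w) (hwsym : symmetric_filter l w)
    (hwdec : decreasing_filter w)
    (hl : (0 < l <= n.-1 %/ 2)%N) :
  let W : 'M[R]_n := structured_mx n bc l w in
  (forall z : R[i], eigenvalue (map_mx (real_complex R) W) z ->
     exists2 x : R, 0 <= x <= 1 & z = real_complex R x) /\
  (exists lambda : 'I_n -> R,
     [/\ char_poly W = \prod_(i < n) ('X - (lambda i)%:P),
         bc = Periodic ->
           forall i : 'I_n, (i = 0%N :> nat -> lambda i = 1) /\
                            ((1 <= i)%N -> 0 <= lambda i < 1),
         bc = Reflective ->
           forall i : 'I_n, (i = 0%N :> nat -> lambda i = 1) /\
                            ((1 <= i)%N -> 0 <= lambda i < 1)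
       & bc = AntiReflective ->
           forall i : 'I_n, ((i < 2)%N -> lambda i = 1) /\
                            ((2 <= i)%N -> 0 <= lambda i < 1)]).
Proof.
move=> W.
have n2 : (2 < n)%N by lia.
(* The spectrum over R[i] consists of the roots of the same product. *)
suff [lambda [charW lambda01 lambdaP lambdaR lambdaAR]] :
  exists lambda : 'I_n -> R,
    [/\ char_poly (structured_mx n bc l w) =
          \prod_(i < n) ('X - (lambda i)%:P),
        forall i, 0 <= lambda i <= 1,
        bc = Periodic -> forall i : 'I_n, (i = 0%N :> nat -> lambda i = 1) /\
                            ((1 <= i)%N -> 0 <= lambda i < 1),
        bc = Reflective -> forall i : 'I_n, (i = 0%N :> nat -> lambda i = 1) /\
                            ((1 <= i)%N -> 0 <= lambda i < 1)
      & bc = AntiReflective -> forall i : 'I_n, ((i < 2)%N -> lambda i = 1) /\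
                            ((2 <= i)%N -> 0 <= lambda i < 1)].
  split; last by exists lambda.
  rewrite /W => z.
  rewrite eigenvalue_root_char -map_char_poly charW rmorph_prod.
  under eq_bigr do rewrite rmorphB /= map_polyX map_polyC.
  by case/root_prodP => i <-; exists (lambda i).
rewrite {W}.
have bound1 k (lambda : 'I_n -> R) :
    (forall i : 'I_n, ((i < k)%N -> lambda i = 1) /\
                      ((k <= i)%N -> 0 <= lambda i < 1)) ->
    forall i, 0 <= lambda i <= 1.
  move=> lambdaE i; have [lt1 ge1] := lambdaE i.
  have [/lt1 ->|/ge1/andP[-> /ltW //]] := ltnP i k.
  by rewrite ler01 lexx.
have [bcE|nAR] : bc = AntiReflective \/ bc <> AntiReflective.
  by case: bc; [right|right|left].
  case: n s hv hl' hw hl n2 bound1 => [|[|m]] // s hv hl' hw hl n2 bound1.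
  have [d charW d01] := anti_reflective_spectrum n2 hw hwsym hv hvsym hwv.
  pose lambda (i : 'I_m.+2) := if unlift ord0 i is Some j then
    if unlift ord0 j is Some k then d k else 1 else 1.
  have lambdaE (i : 'I_m.+2) : ((i < 2)%N -> lambda i = 1) /\
                               ((2 <= i)%N -> 0 <= lambda i < 1).
    rewrite /lambda; case: unliftP => [j ->|-> //].
    by case: unliftP => [k ->|-> //]; split.
  exists lambda; split; rewrite ?bcE //; last exact: bound1 lambdaE.
  rewrite charW !big_ord_recl /lambda unlift_none liftK unlift_none.
  rewrite mulrA -expr2; congr (_ * _); apply: eq_bigr => i _.
  by rewrite !liftK.
have [d charW dE] := simple_top_spectrum n2 hw hwsym hv hvsym hwv nAR.
exists d; split=> //; apply: (bound1 1%N) => i; have [d1 d_lt1] := dE i.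
by split=> // i0; apply: d1; lia.
Qed.
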